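(* Let $L_{U_1},\ldots,L_{U_t}$ be $t$ mutually disjoint scattered $\mathbb{F}_q$-linear sets in $\mathrm{PG}(k-1,q^m)$, all of the same rank $n\ge 1$, with $L_{U_1}\cup\cdots\cup L_{U_t}\neq\mathrm{PG}(k-1,q^m)$, and such that $U_1\cap\cdots\cap U_t$ contains no $1$-dimensional $\mathbb{F}_{q^m}$-subspace. Let $\mathcal{C}=\mathcal{C}(U_1^{\perp'},\ldots,U_t^{\perp'})$ be the geometric dual of a code associated with $(U_1,\ldots,U_t)$, i.e. a code associated with $(U_1^{\perp'},\ldots,U_t^{\perp'})$. If \[ t>(q-1)\cdot\frac{q^m}{q^m-1}, \] then $\mathcal{C}$ is minimal and it satisfies the AB-condition.
   Context: Let $q$ be a prime power. For $\mathbf{n}=(n_1,\ldots,n_t)$ put $\mathbb{F}_{q^m}^{\mathbf{n}}=\bigoplus_{i=1}^t\mathbb{F}_{q^m}^{n_i}$. The rank of $v\in\mathbb{F}_{q^m}^n$ is the $\mathbb{F}_q$-dimension of the $\mathbb{F}_q$-span of its entries; the rank-list of $x=(x_1,\ldots,x_t)$ is $(\mathrm{rk}(x_1),\ldots,\mathrm{rk}(x_t))$, and its sum-rank weight is $\sum_i\mathrm{rk}(x_i)$. An $[\mathbf{n},k]_{q^m/q}$ code is a $k$-dimensional $\mathbb{F}_{q^m}$-subspace of $\mathbb{F}_{q^m}^{\mathbf{n}}$ with the sum-rank distance. A code associated with a tuple $(V_1,\ldots,V_t)$ of $\mathbb{F}_q$-subspaces of $\mathbb{F}_{q^m}^k$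 whose $\mathbb{F}_{q^m}$-span is $\mathbb{F}_{q^m}^k$ is the code generated by $(G_1|\cdots|G_t)$, where the columns of $G_i$ form an $\mathbb{F}_q$-basis of $V_i$. Dual: fix a nondegenerate reflexive sesquilinear form $\sigma$ on $V=\mathbb{F}_{q^m}^k$ and let $\sigma'(x,y)=\mathrm{Tr}_{q^m/q}(\sigma(x,y))$, regarded as a nondegenerate reflexive sesquilinear form on $V$ seen as a $km$-dimensional $\mathbb{F}_q$-space. For an $\mathbb{F}_q$-subspace $U$ of $V$, $U^{\perp'}$ is its orthogonal complement with respect to $\sigma'$. When $U_1\cap\cdots\cap U_t$ contains no $1$-dimensional $\mathbb{F}_{q^m}$-subspace, $(U_1^{\perp'},\ldots,U_t^{\perp'})$ spans $\mathbb{F}_{q^m}^k$ over $\mathbb{F}_{q^m}$, and the geometric dual of a code associated with $(U_1,\ldots,U_t)$ is a code associated with $(U_1^{\perp'},\ldots,U_t^{\perp'})$. Linear sets: for an $\mathbb{F}_q$-subspace $U$ of $\mathbb{F}_{q^m}^k$ of $\mathbb{F}_q$-dimension $n$, $L_U=\{\langle u\rangle_{\mathbb{F}_{q^m}}:u\in U\setminus\{0\}\}\subseteq\mathrm{PG}(k-1,q^m)$ is an $\mathbb{F}_q$-linear set of rank $n$. It is scattered if $\dim_{\mathbb{F}_q}(U\cap\langle v\rangle_{\mathbb{F}_{q^m}})\le1$ for all $v\ne0$. Minimality: fix an $\mathbb{F}_q$-basis of $\mathbb{F}_{q^m}$; for $x_i\in\mathbb{F}_{q^m}^{n_i}$ let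 $\Gamma(x_i)\in\mathbb{F}_q^{n_i\times m}$ be the matrix whose $j$-th row consists of the coordinates of the $j$-th entry of $x_i$. The sum-rank support of $x$ is the tuple of $\mathbb{F}_q$-column spaces of $\Gamma(x_1),\ldots,\Gamma(x_t)$; inclusion is componentwise. $\mathcal{C}$ is minimal if for all $c,c'\in\mathcal{C}$, whenever the support of $c'$ is contained in that of $c$, $c'=\lambda c$ for some $\lambda\in\mathbb{F}_{q^m}$. AB-condition: an $[(\nu_1,\ldots,\nu_t),k]_{q^m/q}$ code $\mathcal{C}$ satisfies the AB-condition if $\delta_{\max}/\delta_{\min}<q^m/(q^m-1)$, where $\delta_{\max}$ and $\delta_{\min}$ are the maximum and minimum of $\sum_{i=1}^t\frac{q^{\nu_i}-q^{\nu_i-r_i}}{q-1}$ over the rank-lists $(r_1,\ldots,r_t)$ of nonzero codewords of $\mathcal{C}$. *)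

(* Defs.v *)
From HB Require Import structures.
From mathcomp Require Import all_boot all_order all_algebra.
From mathcomp Require Import all_field.
From mathcomp Require Import sesquilinear.

Set Implicit Arguments.
Unset Strict Implicit.
Unset Printing Implicit Defensive.

Import Order.TTheory GRing.Theory Num.Theory.
Local Open Scope ring_scope.

(* F plays the role of F_q (q = #|F|) and L that of F_{q^m} (m = \dim {:L}).
   Every finite extension of a finite field is a splitting field, so asking for
   a splittingFieldType (needed by galTrace) is no restriction.                *)

(* The set L^k carries two vector space structures: Lspace k over L, and
   Fspace k (restriction of scalars) over F.  The two types are convertible,
   so a vector can be used at either of them.                                  *)
Definition Lspace (F : finFieldType) (L : splittingFieldType F) (k : nat) :
  vectType L := {ffun 'I_k -> L^o}.

Definition Fspace (F : finFieldType) (L : splittingFieldType F) (k : nat) :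
  vectType F := {ffun 'I_k -> L}.

Section FieldExtension.
Variables (F : finFieldType) (L : splittingFieldType F).

Section Geometry.
Variable k : nat.
Local Notation V := (Lspace L k).
Local Notation W := (Fspace L k).

Definition scale_vec (v : V) (a : L) : W := (a *: v : V).

Lemma scale_vec_is_linear (v : V) : linear (scale_vec v).
Proof.
move=> a x y; apply/ffunP=> i; rewrite !ffunE /=.
by rewrite [LHS]mulrDl -scalerAl.
Qed.
HB.instance Definition _ (v : V) :=
  GRing.isLinear.Build F L W *:%R (scale_vec v) (scale_vec_is_linear v).

(* <v>_L as an F-subspace *)
Definition Lline (v : V) : {vspace W} := limg (linfun (scale_vec v)).

Lemma mem_Lline (v : V) (w : W) :
  reflect (exists a : L, w = (a *: v : V)) (w \in Lline v).
Proof.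
apply: (iffP memv_imgP) => [[a _ ->]|[a ->]]; exists a; rewrite ?memvf //.
all: by rewrite lfunE.
Qed.

(* The points of PG(k-1, q^m), and the linear set L_U as a set of points. *)
Definition pg_point (P : {vspace V}) : Prop := \dim P = 1%N.

Definition linear_set (U : {vspace W}) (P : {vspace V}) : Prop :=
  exists2 u : W, u \in U /\ u != 0 & P = <[(u : V)]>%VS.

Definition scattered (U : {vspace W}) : Prop :=
  forall v : V, v != 0 -> (\dim (U :&: Lline v) <= 1)%N.

(* P is an L-subspace all of whose vectors lie in the F-subspace U. *)
Definition contains_Lsub (U : {vspace W}) (P : {vspace V}) : Prop :=
  forall v : V, v \in P -> (v : W) \in U.

(* sigma is linear in the first argument and theta-semilinear in the
   second; an endomorphism theta of the finite field L is an automorphism.     *)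
Definition reflexive_form (theta : {rmorphism L -> L})
    (sigma : {bilinear V -> V -> L | *%R & theta \; *%R}) : Prop :=
  forall x y : V, sigma x y = 0 -> sigma y x = 0.

Definition nondegenerate_form (theta : {rmorphism L -> L})
    (sigma : {bilinear V -> V -> L | *%R & theta \; *%R}) : Prop :=
  forall x : V, (forall y : V, sigma x y = 0) -> x = 0.

Section Orthogonal.
Variables (theta : {rmorphism L -> L})
          (sigma : {bilinear V -> V -> L | *%R & theta \; *%R}).

(* The values lie in the copy 1%VS of F in L. *)
Definition trace_form (x y : W) : L :=
  galTrace 1%VS {:L} (sigma (x : V) (y : V)).

Definition trace_form_l (y x : W) : L := trace_form x y.

Lemma trace_form_l_is_linear (y : W) : linear (trace_form_l y).
Proof.
move=> a x z; rewrite /trace_form_l /trace_form.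
have -> : (a *: x + z : W) = ((a%:A : L) *: (x : V) + (z : V) : V) :> V.
  by apply/ffunP=> i; rewrite !ffunE /= /GRing.scale /= mulr_algl.
rewrite linearPl /= raddfD /=; congr (_ + _).
rewrite /galTrace scaler_sumr; apply: eq_bigr => g _.
by rewrite mulr_algl linearZ.
Qed.
HB.instance Definition _ (y : W) :=
  GRing.isLinear.Build F W L *:%R (trace_form_l y) (trace_form_l_is_linear y).

(* The complement is taken on the left; for a reflexive form both sides agree.
   finvect_type only makes the finiteness of W available for indexing.       *)
Definition trace_perp (U : {vspace W}) : {vspace W} :=
  (\bigcap_(u : finvect_type W | (u : W) \in U)
      lker (linfun (trace_form_l u)))%VS.

Lemma mem_trace_perp (U : {vspace W}) (x : W) :
  x \in trace_perp U <-> (forall u : W, u \in U -> trace_form x u = 0).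
Proof.
rewrite memvE; split=> [/subv_bigcapP xU u uU | xU].
  by have := xU u uU; rewrite -memvE memv_ker lfunE => /eqP.
by apply/subv_bigcapP => u uU; rewrite -memvE memv_ker lfunE; apply/eqP/xU.
Qed.

End Orthogonal.

Definition Lspan (U : {vspace W}) : {vspace V} :=
  (\sum_(u : finvect_type W | (u : W) \in U) <[(u : V)]>)%VS.

Definition Lspanning (t : nat) (U : 'I_t -> {vspace W}) : Prop :=
  (\sum_(i < t) Lspan (U i))%VS = fullv.

End Geometry.

Section Codes.
Variables (t : nat) (nu : 'I_t -> nat).

(* F_{q^m}^(nu_1, ..., nu_t) is 'rV[L]_(\sum_i nu i); the i-th block of x is
   submxrow x i.                                                               *)
Local Notation A := 'rV[L]_(\sum_i nu i).

Definition rk (n : nat) (v : 'rV[L]_n) : nat :=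
  \dim <<[seq v ord0 j | j : 'I_n]>>%VS.

Definition rank_list (x : A) (i : 'I_t) : nat := rk (submxrow x i).

Definition col_vec (k n : nat) (M : 'M[L]_(k, n)) (j : 'I_n) : Fspace L k :=
  [ffun r => M r j].

Definition generated_code (k : nat) (G : forall i, 'M[L]_(k, nu i)) :
  {vspace A} := <<[seq row r (\mxrow_i G i) | r : 'I_k]>>%VS.

Definition associated_code (k : nat) (U : 'I_t -> {vspace (Fspace L k)})
    (C : {vspace A}) : Prop :=
  Lspanning U /\
  exists2 G : (forall i, 'M[L]_(k, nu i)),
    (forall i, basis_of (U i) [seq col_vec (G i) j | j : 'I_(nu i)]) &
    C = generated_code G.

Definition Gamma (m n : nat) (B : m.-tuple L) (v : 'rV[L]_n) : 'M[F]_(n, m) :=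
  \matrix_(j, l) coord B l (v ord0 j).

Definition support (m : nat) (B : m.-tuple L) (x : A) (i : 'I_t) :
  {vspace 'cV[F]_(nu i)} :=
  <<[seq col l (Gamma B (submxrow x i)) | l : 'I_m]>>%VS.

Definition minimal_code (m : nat) (B : m.-tuple L) (C : {vspace A}) : Prop :=
  forall c c' : A, c \in C -> c' \in C ->
  (forall i, (support B c' i <= support B c i)%VS) ->
  exists lambda : L, c' = lambda *: c.

(* The truncated subtraction nu i - r_i is exact since rk x_i <= nu i. *)
Definition delta (x : A) : rat :=
  \sum_(i < t) (#|F|%:R ^+ nu i - #|F|%:R ^+ (nu i - rank_list x i)%N)
               / (#|F|%:R - 1).

Definition is_delta_max (C : {vspace A}) (d : rat) : Prop :=
  (exists2 c : A, c \in C /\ c != 0 & delta c = d) /\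
  (forall c : A, c \in C -> c != 0 -> delta c <= d).

Definition is_delta_min (C : {vspace A}) (d : rat) : Prop :=
  (exists2 c : A, c \in C /\ c != 0 & delta c = d) /\
  (forall c : A, c \in C -> c != 0 -> d <= delta c).

Definition AB_condition (C : {vspace A}) : Prop :=
  exists dmax dmin : rat,
  [/\ is_delta_max C dmax, is_delta_min C dmin &
      dmax / dmin < #|F|%:R ^+ \dim {:L} / (#|F|%:R ^+ \dim {:L} - 1)].

End Codes.
End FieldExtension.

(* Main.v *)
Require Import Defs.
From HB Require Import structures.
From mathcomp Require Import all_boot all_order all_algebra.
From mathcomp Require Import all_field.
From mathcomp Require Import sesquilinear.

(* Write Q = q^m. Nondegeneracy of sigma identifies the codewords with the
   vectors v of L^k, and the i-th block of the codeword of v has rank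
   m - w_i(v), where w_i(v) = dim_F (U_i :&: <v>_L), because the functional
   sigma(-, v) has kernel <v>_L^perp' and U_i^perp' :&: <v>_L^perp' =
   (U_i + <v>_L)^perp'. Scatteredness and disjointness give
   sum_i w_i(v) <= 1, so delta takes exactly the two values q^e D and
   q^e (D - 1) with D = t (Q - 1) / (q - 1) and e = km - m - n; the hypothesis
   on t says Q < D, which is the AB-condition.
   For minimality, an inclusion of supports dualizes to
   <v'>_L <= U_i + <v>_L for all i; when v' is not a multiple of v this forces
   too many points of the linear sets on the line through v and v'. *)

Set Implicit Arguments.
Unset Strict Implicit.
Unset Printing Implicit Defensive.

Import Order.TTheory GRing.Theory Num.Theory.
Local Open Scope ring_scope.

(** * The trace from [L] to [F], and endomorphisms of [L] *)

Section Trace.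
Variables (F : finFieldType) (L : splittingFieldType F).

Lemma galTrace_in1 (a : L) : galTrace 1%VS {:L} a \in 1%VS.
Proof.
have gal1L : galois 1%VS {:L} by apply: finField_galois; apply: sub1v.
by apply: (mem_galTrace gal1L); apply: memvf.
Qed.

Lemma galTrace_scale (c a : L) :
  c \in 1%VS -> galTrace 1%VS {:L} (c * a) = c * galTrace 1%VS {:L} a.
Proof.
case/vlineP=> b ->; rewrite /galTrace !mulr_algl scaler_sumr.
by apply: eq_bigr => g _; rewrite linearZ.
Qed.

(** Galois automorphisms are independent, so their sum, the trace, is nonzero at some [d]; if
    [a != 0], taking [b = d / a] contradicts the assumption. *)
Lemma galTrace_mul_eq0 (a : L) :
  (forall b, galTrace 1%VS {:L} (b * a) = 0) -> a = 0.
Proof.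
move=> tr0; apply/eqP; apply/negPn/negP=> a0.
have [] := @gal_independent_contra F L {:L}%AS [in 'Gal({:L} / 1%AS)%g]
  (fun=> 1) 1%g (fingroup.group1 _) (oner_neq0 _).
move=> d _ /negP[]; apply/eqP.
have := tr0 (d / a); rewrite divfK //; apply: etrans.
by apply: eq_bigr => g _; rewrite mul1r.
Qed.

(** The copy of [F] in [L] is the set of roots of X^q = X with q = [#|F|], an equation that ring
    morphisms preserve. *)
Lemma rmorph_in1 (theta : {rmorphism L -> L}) (c : L) :
  c \in 1%VS -> theta c \in 1%VS.
Proof.
by rewrite !(Fermat's_little_theorem 1%AS) -rmorphXn => /eqP->.
Qed.

Lemma rmorph_surj (theta : {rmorphism L -> L}) (c : L) :
  exists a, theta a = c.
Proof.
pose f (x : finvect_type L) : finvect_type L := theta x.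
have /injF_bij[g _ fK] : injective f by apply: fmorph_inj.
by exists (g c); apply: fK.
Qed.

End Trace.

(** * Orthogonal complements for the trace form, and representation of functionals by [sigma] *)

Section Form.
Variables (F : finFieldType) (L : splittingFieldType F) (k : nat).
Local Notation V := (Lspace L k).
Local Notation W := (Fspace L k).

Lemma Fspace_scaleE (a : F) (w : W) : (a *: w : W) = (a%:A *: (w : V) : V).
Proof. by apply/ffunP=> i; rewrite !ffunE /GRing.scale /= mulr_algl. Qed.

Lemma LlineS (a : L) (v : V) : (a *: v : V) \in (Lline v : {vspace W}).
Proof. by apply/mem_Lline; exists a. Qed.

Lemma dim_Lline (v : V) : v != 0 -> \dim (Lline v) = \dim {:L}.
Proof.
move=> v0; rewrite /Lline -(limg_ker_dim (linfun (scale_vec v)) fullv).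
suff -> : lker (linfun (scale_vec v)) = 0%VS by rewrite capv0 dimv0.
apply/eqP; rewrite -subv0; apply/subvP=> a; rewrite memv_ker lfunE /=.
move=> /eqP av0; have /eqP : (a *: v : V) = 0 by exact: av0.
by rewrite scaler_eq0 (negPf v0) orbF memv0.
Qed.

Variables (theta : {rmorphism L -> L})
          (sigma : {bilinear V -> V -> L | *%R & theta \; *%R}).
Hypothesis sigma_nondeg : nondegenerate_form sigma.
Local Notation b := (trace_form sigma).
Local Notation perp := (trace_perp sigma).

Lemma trace_formDr x : {morph b x : y z / y + z}.
Proof. by move=> y z; rewrite /trace_form linearDr raddfD. Qed.

Lemma trace_formZr (a : F) (x y : W) : b x (a *: y) = theta a%:A * b x y.
Proof.
rewrite /trace_form Fspace_scaleE (linearZr_LR sigma) /=.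
by rewrite galTrace_scale // rmorph_in1 // rpredZ // mem1v.
Qed.

(** Since [theta] is onto, the values of the trace form at [x] against [Lline v] are the traces of
    all [L]-multiples of [sigma x v]; they vanish together only if [sigma x v = 0]. *)
Lemma trace_form_Lline (x : W) (v : V) :
  (forall u, u \in Lline v -> b x u = 0) <-> sigma x v = 0.
Proof.
split=> [xv0 | xv0 u /mem_Lline[a ->]]; last first.
  by rewrite /trace_form (linearZr_LR sigma) /= xv0 mulr0 raddf0.
apply: galTrace_mul_eq0 => c; have [a <-] := rmorph_surj theta c.
by have := xv0 _ (LlineS a v); rewrite /trace_form (linearZr_LR sigma).
Qed.

Lemma trace_perpD (U1 U2 : {vspace W}) :
  perp (U1 + U2)%VS = (perp U1 :&: perp U2)%VS.
Proof.
apply/vspaceP=> x; rewrite memv_cap.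
apply/idP/andP => [/mem_trace_perp xU |
                   [/mem_trace_perp xU1 /mem_trace_perp xU2]].
  split; apply/mem_trace_perp=> u uU; apply: xU.
    by rewrite (subvP (addvSl _ _)).
  by rewrite (subvP (addvSr _ _)).
apply/mem_trace_perp=> _ /memv_addP[u uU1 [w wU2 ->]].
by rewrite trace_formDr xU1 // xU2 // addr0.
Qed.

Lemma trace_perp_line (y : W) :
  perp <[y]>%VS = lker (linfun (trace_form_l sigma y)).
Proof.
apply/vspaceP=> x; rewrite memv_ker lfunE /=.
apply/idP/eqP => [/mem_trace_perp xy | xy0].
  by apply: xy; apply: memv_line.
apply/mem_trace_perp=> _ /vlineP[a ->].
by rewrite trace_formZr [b x y]xy0 mulr0.
Qed.

Lemma trace_perp0 : perp 0%VS = fullv.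
Proof.
apply/vspaceP=> x; rewrite memvf; apply/mem_trace_perp=> u.
by rewrite memv0 => /eqP->; rewrite /trace_form linear0r raddf0.
Qed.

Lemma trace_perpT : perp fullv = 0%VS.
Proof.
apply/eqP; rewrite -subv0; apply/subvP=> x /mem_trace_perp x0.
rewrite memv0; apply/eqP/sigma_nondeg=> y.
by apply/trace_form_Lline=> u _; rewrite x0 ?memvf.
Qed.

(** One more orthogonality condition is the kernel of a functional with values in the line [1%VS],
    so by rank-nullity it costs at most one dimension. *)
Lemma dim_trace_perp_line (U : {vspace W}) (y : W) :
  (\dim (perp U) <= (\dim (perp (U + <[y]>)%VS)).+1)%N.
Proof.
rewrite trace_perpD trace_perp_line.
rewrite -(limg_ker_dim (linfun (trace_form_l sigma y)) (perp U)).
rewrite -addn1 leq_add2l; apply: (@leq_trans (\dim (1%VS : {vspace L}))).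
  by apply/dimvS/subvP=> _ /memv_imgP[x _ ->]; rewrite lfunE galTrace_in1.
by rewrite dimv1.
Qed.

Lemma dim_trace_perp_span (U : {vspace W}) (s : seq W) :
  (\dim (perp U) <= \dim (perp (U + <<s>>)%VS) + size s)%N.
Proof.
elim: s U => [|y s IHs] U; first by rewrite span_nil addv0 addn0.
rewrite span_cons addvA addnS -addSn.
apply: leq_trans (dim_trace_perp_line U y) _.
by rewrite addSn ltnS.
Qed.

(** [U2] is reached from [U1] by adjoining the vectors of a basis of a complement, each costing at
    most one dimension of the orthogonal. *)
Lemma dim_trace_perpS (U1 U2 : {vspace W}) : (U1 <= U2)%VS ->
  (\dim (perp U1) + \dim U1 <= \dim (perp U2) + \dim U2)%N.
Proof.
move=> sU; have := dim_trace_perp_span U1 (vbasis (U2 :\: U1)%VS).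
rewrite (span_basis (vbasisP _)) size_tuple.
rewrite addvC addv_diff (addv_idPl sU).
rewrite -(leq_add2r (\dim U1)) => /leq_trans-> //.
rewrite -addnA leq_add2l -(dimv_cap_compl U2 U1) addnC leq_add2r.
by rewrite (capv_idPr sU).
Qed.

(** The monotone quantity of [dim_trace_perpS] equals [\dim {:W}] at both extremes, the zero space
    and the full space, hence everywhere between. *)
Lemma dim_trace_perp (U : {vspace W}) :
  (\dim (perp U) + \dim U)%N = \dim {:W}.
Proof.
apply/eqP; rewrite eqn_leq.
have := dim_trace_perpS (subvf U); rewrite trace_perpT dimv0 add0n => -> /=.
by have := dim_trace_perpS (sub0v U); rewrite trace_perp0 dimv0 addn0.
Qed.

Lemma trace_perp_inj_sub (U1 U2 : {vspace W}) :
  (perp U1 <= perp U2)%VS -> (U2 <= U1)%VS.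
Proof.
move=> sP; have eqP12 : perp (U1 + U2)%VS = perp U1.
  by rewrite trace_perpD; apply/capv_idPl.
have := dim_trace_perp (U1 + U2)%VS; rewrite eqP12 -(dim_trace_perp U1).
move/addnI=> eqd; apply/addv_idPl/esym/eqP.
by rewrite -(dimv_leqif_eq (addvSl U1 U2)) eqd.
Qed.

Hypothesis sigma_refl : reflexive_form sigma.

Lemma Lspace_basisE (u : V) :
  u = \sum_r u r *: ([ffun s => (s == r)%:R] : V).
Proof.
apply/ffunP=> s; rewrite sum_ffunE (bigD1 s) //= big1 => [|r rs].
  by rewrite !ffunE eqxx addr0 /GRing.scale /= mulr1.
by rewrite !ffunE eq_sym (negPf rs) scaler0.
Qed.

Lemma sigma_coords (v : V) :
  exists x : 'I_k -> L, forall u : V, sigma u v = \sum_r x r * u r.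
Proof.
exists (fun r => sigma ([ffun s => (s == r)%:R] : V) v) => u.
rewrite [in LHS](Lspace_basisE u) linear_sumlz; apply: eq_bigr => r _.
by rewrite linearZl_LR mulrC.
Qed.

(** The map sending [v] to the values of [sigma] at the unit vectors is an injective self-map of a
    finite set, hence onto. Reflexivity turns the right radical into the left one, where
    nondegeneracy applies. *)
Lemma sigma_surj (x : 'I_k -> L) :
  exists v : V, forall u : V, sigma u v = \sum_r x r * u r.
Proof.
pose e (r : 'I_k) : V := [ffun s => (s == r)%:R].
pose f (v : finvect_type W) : finvect_type W := [ffun r => sigma (e r) (v : V)].
have finj : injective f.
  move=> v w /ffunP vw; apply/eqP; rewrite -subr_eq0; apply/eqP.
  apply: sigma_nondeg => y; apply: sigma_refl.
  rewrite (Lspace_basisE y) linear_sumlz big1 // => r _.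
  rewrite linearZl_LR linearBr /=.
  by have := vw r; rewrite !ffunE => ->; rewrite subrr mulr0.
have [g _ gK] := injF_bij finj; exists (g [ffun r => x r]) => u.
rewrite [in LHS](Lspace_basisE u) linear_sumlz; apply: eq_bigr => r _.
rewrite linearZl_LR mulrC; congr (_ * _).
by have /ffunP/(_ r) := gK [ffun r => x r]; rewrite !ffunE.
Qed.

End Form.

(** * Codewords of the dual code: parametrization, ranks and supports *)

Section DualCode.
Variables (F : finFieldType) (L : splittingFieldType F) (k : nat).
Local Notation V := (Lspace L k).
Local Notation W := (Fspace L k).
Variables (theta : {rmorphism L -> L})
          (sigma : {bilinear V -> V -> L | *%R & theta \; *%R}).
Hypotheses (sigma_nondeg : nondegenerate_form sigma)
           (sigma_refl : reflexive_form sigma).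
Local Notation perp := (trace_perp sigma).

Definition sigma_l (v : V) (u : W) : L := sigma (u : V) v.

Lemma sigma_l_is_linear (v : V) : linear (sigma_l v).
Proof.
move=> a x y; rewrite /sigma_l.
by rewrite Fspace_scaleE (linearDl sigma) linearZl_LR /= mulr_algl.
Qed.
HB.instance Definition _ (v : V) :=
  GRing.isLinear.Build F W L *:%R (sigma_l v) (sigma_l_is_linear v).

Lemma trace_perp_Lline (v : V) : perp (Lline v) = lker (linfun (sigma_l v)).
Proof.
apply/vspaceP=> x; rewrite memv_ker lfunE.
by apply/idP/eqP => [/mem_trace_perp/trace_form_Lline |
                     /trace_form_Lline/mem_trace_perp].
Qed.

Variables (t : nat) (nu : 'I_t -> nat) (G : forall i, 'M[L]_(k, nu i)).
Local Notation A := 'rV[L]_(\sum_i nu i).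

(** The message is encoded by the vector [v] representing it through [sigma], so that the entries
    are values of one functional on the basis vectors of the complements. *)
Definition codeword (v : V) : A :=
  \mxrow_i \row_j sigma (col_vec (G i) j : V) v.

Lemma codewordE v i j :
  submxrow (codeword v) i ord0 j = sigma (col_vec (G i) j : V) v.
Proof. by rewrite mxrowK mxE. Qed.

Lemma mem_generated_code (c : A) :
  c \in generated_code G <->
  exists x : 'I_k -> L, forall i j,
    submxrow c i ord0 j = \sum_r x r * G i r j.
Proof.
have blockE (x : 'I_k -> L) i j :
    submxrow (\sum_r x r *: row r (\mxrow_i G i)) i ord0 j =
    \sum_r x r * G i r j.
  rewrite submxrow_sum summxE; apply: eq_bigr => r _.
  by rewrite -[in RHS](mxrowK G i) /submxrow !mxE.
rewrite /generated_code span_def big_image /=; split.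
  case/memv_sumP=> y yP ->.
  have yE r : exists a, y r == a *: row r (\mxrow_i G i).
    by have /vlineP[a ->] := yP r isT; exists a.
  exists (fun r => xchoose (yE r)) => i j; rewrite -blockE.
  congr (submxrow _ i ord0 j); apply: eq_bigr => r _; apply/eqP.
  exact: xchooseP (yE r).
case=> x cE.
have -> : c = \sum_r x r *: row r (\mxrow_i G i).
  rewrite -[LHS]submxrowK -[RHS]submxrowK; apply/eq_mxrow => i.
  by apply/rowP=> j; rewrite cE blockE.
by apply: memv_sumr => r _; rewrite memvZ // memv_line.
Qed.

Lemma generated_code_codeword (c : A) :
  c \in generated_code G <-> exists v, c = codeword v.
Proof.
split=> [/mem_generated_code[x cE] | [v ->]].
  have [v vE] := sigma_surj sigma_nondeg sigma_refl x; exists v.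
  rewrite -[c]submxrowK; apply/eq_mxrow=> i; apply/rowP=> j.
  by rewrite cE mxE vE; apply: eq_bigr => r _; rewrite ffunE.
have [x xE] := sigma_coords sigma v.
apply/mem_generated_code; exists x => i j; rewrite codewordE xE.
by apply: eq_bigr => r _; rewrite ffunE.
Qed.

Lemma codewordZ a v : codeword (a *: v) = theta a *: codeword v.
Proof.
rewrite -[LHS]submxrowK -[RHS]submxrowK; apply/eq_mxrow=> i; apply/rowP=> j.
rewrite codewordE linearZr_LR /= -codewordE.
by rewrite /submxrow !mxE.
Qed.

Variable U : 'I_t -> {vspace W}.
Hypothesis G_basis : forall i,
  basis_of (perp (U i)) [seq col_vec (G i) j | j : 'I_(nu i)].

Lemma dim_perp_nu i : \dim (perp (U i)) = nu i.
Proof.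
by case/andP: (G_basis i) => /eqP<- /eqP->; rewrite size_image card_ord.
Qed.

(** Rank-nullity for [sigma_l v] on [perp (U i)]: the image is spanned by the entries of block
    [i]. *)
Lemma rank_list_codeword v i :
  (\dim (perp (U i + Lline v)%VS) + rank_list (codeword v) i)%N = nu i.
Proof.
rewrite -dim_perp_nu -(limg_ker_dim (linfun (sigma_l v)) (perp (U i))).
rewrite trace_perpD trace_perp_Lline -{3}(span_basis (G_basis i)) limg_span.
congr (_ + \dim (span _))%N; rewrite -map_comp; apply: eq_map => j /=.
by rewrite codewordE lfunE.
Qed.

(** A vector of [perp (U i)] with coordinates [y] is killed by [sigma_l w] exactly when [y]
    annihilates the support of the codeword of [w] (this is [ann]). Inclusion of supports thus
    reverses to inclusion of kernels, and taking complements reverses it back. *)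
Lemma support_codeword m (B : m.-tuple L) (v v' : V) (i : 'I_t) :
  basis_of {:L}%VS B ->
  (Defs.support B (codeword v') i <= Defs.support B (codeword v) i)%VS ->
  (Lline v' <= U i + Lline v)%VS.
Proof.
move=> hB sub; suff : (perp (U i + Lline v)%VS <= perp (Lline v'))%VS.
  exact: trace_perp_inj_sub.
rewrite trace_perpD !trace_perp_Lline; apply/subvP=> u.
rewrite memv_cap !memv_ker !lfunE /= => /andP[uU uv].
have {uU}[y uE] : exists y : 'I_(nu i) -> F,
    u = \sum_j y j *: col_vec (G i) j.
  move: uU; rewrite -(span_basis (G_basis i)) span_def big_image /=.
  case/memv_sumP=> z zP ->.
  have zE j : exists a, z j == a *: col_vec (G i) j.
    by have /vlineP[a ->] := zP j isT; exists a.
  exists (fun j => xchoose (zE j)).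
  by apply: eq_bigr => j _; apply/eqP; exact: xchooseP (zE j).
have coordE w l : coord B l (sigma_l w u) =
    ((\row_j y j) *m col l (Gamma B (submxrow (codeword w) i))) ord0 ord0.
  rewrite uE !linear_sum mxE /=; apply: eq_bigr => j _.
  rewrite linearZZ /= [LHS]linearZ /= !mxE; congr (_ * _).
  by have := codewordE w j; rewrite /submxrow !mxE => ->.
have ann x : sigma_l x u = 0 <->
    forall z, z \in Defs.support B (codeword x) i -> (\row_j y j) *m z = 0.
  split=> [w0 z | w0].
    rewrite /Defs.support span_def big_image /=; case/memv_sumP=> zl zP ->.
    rewrite mulmx_sumr big1 // => l _; have /vlineP[a ->] := zP l isT.
    apply/matrixP=> p q; rewrite !ord1 -scalemxAr [LHS]mxE -coordE w0.
    by rewrite linear0 mulr0 mxE.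
  rewrite (coord_basis hB (memvf (sigma_l x u))) big1 // => l _.
  rewrite coordE w0 ?mxE ?scale0r //.
  by apply: memv_span; apply: image_f.
apply/eqP/ann=> z zv'; apply: (ann v).1; first exact/eqP.
exact: (subvP sub).
Qed.

End DualCode.

(** * Incidences between lines and the linear sets *)

Section Count.
Variables (F : finFieldType) (L : splittingFieldType F) (k t : nat).
Local Notation V := (Lspace L k).
Local Notation W := (Fspace L k).
Variable U : 'I_t -> {vspace W}.
Hypotheses (U_scattered : forall i, scattered (U i))
  (U_disjoint : forall i j, i != j ->
     forall P, ~ (linear_set (U i) P /\ linear_set (U j) P)).
Local Notation q := #|F|.
Local Notation Q := (#|F| ^ \dim {:L})%N.

Lemma linear_set_line (D : {vspace W}) (a : L) (w : V) :
  a != 0 -> w != 0 -> ((a *: w : V) : W) \in D -> linear_set D <[w]>%VS.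
Proof.
move=> a0 w0 awD; exists (a *: w : V).
  split=> //; have := scaler_eq0 a w.
  by rewrite (negPf a0) (negPf w0) => /negbT.
apply/eqP; rewrite eqEdim !dim_vline scaler_eq0 (negPf w0) (negPf a0) /= andbT.
by apply/vlineP; exists a^-1; rewrite scalerK.
Qed.

Lemma linear_set_meet (D : {vspace W}) (w : V) : w != 0 ->
  linear_set D <[w]>%VS <-> (0 < \dim (D :&: Lline w))%N.
Proof.
move=> w0; split=> [[u [uD u0] eq_wu] | ].
  rewrite lt0n dimv_eq0; apply/eqP=> cap0; case/eqP: u0; apply/eqP.
  rewrite -memv0 -cap0 memv_cap uD /=; apply/mem_Lline.
  have /vlineP[a uE] : (u : V) \in <[w]>%VS by rewrite eq_wu memv_line.
  by exists a.
rewrite lt0n dimv_eq0 -vpick0 => pick0.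
have := memv_pick (D :&: Lline w); rewrite memv_cap.
case/andP=> uD /mem_Lline[a ua]; apply: (@linear_set_line D a) => //.
  by apply: contraNneq pick0 => a0; rewrite ua a0 scale0r.
by rewrite -ua.
Qed.

Lemma dim_meet_le1 (w : V) : w != 0 ->
  (\sum_(i < t) \dim (U i :&: Lline w) <= 1)%N.
Proof.
move=> w0; have [/existsP[i iw] | none] :=
    boolP [exists i, 0 < \dim (U i :&: Lline w)]%N; last first.
  rewrite big1 // => i _; apply/eqP.
  by move: none; rewrite negb_exists => /forallP/(_ i); rewrite lt0n negbK.
rewrite (bigD1 i) //= big1 ?addn0; first exact: U_scattered.
move=> j ji; apply/eqP; rewrite -leqn0 leqNgt; apply/negP.
move=> jw; apply: (U_disjoint ji (P := <[w]>%VS)).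
by split; apply/linear_set_meet.
Qed.

(** Disjointness leaves a single index [i] for all pairs; scatteredness then leaves at most q - 1
    nonzero vectors of [U i] on the line of [w]. *)
Lemma Lline_scalars_count (w : V) : w != 0 ->
  (#|[set p : 'I_t * finvect_type L |
       ((p.2 != 0) && (((p.2 : L) *: w : V) \in U p.1))%R]| <= q.-1)%N.
Proof.
move=> w0; set S := [set p | _].
have [-> | [[i a]]] := set_0Vmem S; first by rewrite cards0.
rewrite inE /= => /andP[a0 aU].
have memSi p : p \in S -> p.1 = i.
  rewrite inE => /andP[p0 pU]; apply/eqP/negPn/negP=> pi.
  apply: (U_disjoint pi (P := <[w]>%VS)).
  by split; [apply: linear_set_line p0 w0 pU | apply: linear_set_line a0 w0 aU].
pose f (p : 'I_t * finvect_type L) : finvect_type W := ((p.2 : L) *: w : V).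
pose Y := [set x : finvect_type W | (x : W) \in (U i :&: Lline w)%VS].
pose X := Y :\ 0.
have f_inj : {in S &, injective f}.
  move=> p p' /memSi pi /memSi p'i /eqP.
  rewrite /f -subr_eq0 -(scalerBl _ _ w) (scaler_eq0 _ w) (negPf w0) orbF.
  rewrite subr_eq0.
  by move=> pp'; apply/eqP; rewrite -pair_eqE /pair_eq pi p'i eqxx.
have cardX : (#|X| <= q.-1)%N.
  rewrite -ltnS (ltn_predK (finNzRing_gt1 F)).
  have := cardsD1 (0 : finvect_type W) Y.
  rewrite inE mem0v add1n => <-.
  rewrite cardsE card_vspace -[X in (_ <= X)%N]expn1.
  rewrite leq_exp2l ?finNzRing_gt1 //.
  exact: U_scattered.
apply: leq_trans cardX; rewrite -(card_in_imset f_inj); apply: subset_leq_card.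
apply/subsetP=> _ /imsetP[p pS ->]; have pi := memSi p pS.
move: pS; rewrite inE pi => /andP[p0 pU].
rewrite !inE memv_cap pU LlineS !andbT.
by have := scaler_eq0 (p.2 : L) w; rewrite (negPf p0) (negPf w0) => /negbT.
Qed.

(* Every [a *: v'] is congruent modulo [Lline v] to a vector of [U i], hence
   determines a point [v' + lam *: v] of the line through [v] and [v'], other
   than [v], lying on the linear set of [U i]: these t (Q - 1) incidences are
   distributed over Q points, each of them receiving at most q - 1. *)
Lemma incidence_count (v v' : V) :
  (forall a : L, v' != a *: v) ->
  (forall i, (Lline v' <= U i + Lline v)%VS) -> (t * Q.-1 <= Q * q.-1)%N.
Proof.
move=> v'v sub.
have cardL : #|finvect_type L| = Q.
  rewrite -(@card_vspace F (finvect_type L) _ {:L}%VS).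
  by apply/esym/eq_card=> x; rewrite memvf.
pose S (lam : finvect_type L) := [set p : 'I_t * finvect_type L |
  (p.2 != 0) && (((p.2 : L) *: (v' + (lam : L) *: v) : V) \in U p.1)].
have leS lam : (#|S lam| <= q.-1)%N.
  apply: Lline_scalars_count; rewrite addr_eq0 -scaleNr; exact: v'v.
have covered p : p.2 != 0 -> exists lam, p \in S lam.
  case: p => i a /= a0.
  have /memv_addP[u uU [w /mem_Lline[b wE] avE]] :=
    subvP (sub i) _ (LlineS a v').
  (* From [a *: v' = u + b *: v] with [u] in [U i], this scalar makes [a *: (v' + lam *: v)] equal
     to [u]. *)
  exists (- (a^-1 * b)); rewrite inE /= a0 scaleNr scalerBr scalerA mulVKf //.
  suff -> : (a *: v' : V) - b *: v = u by [].
  by rewrite avE wE addrK.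
pose D := [set p : 'I_t * finvect_type L | p.2 != 0].
have <- : #|D| = (t * Q.-1)%N.
  have -> : D = setX [set: 'I_t] [set~ 0].
    by apply/setP=> p; rewrite !inE.
  by rewrite cardsX cardsT card_ord cardsC1 cardL.
rewrite -sum1_card.
apply: (@leq_trans (\sum_(p in D) \sum_lam (p \in S lam))%N).
  apply: leq_sum => p; rewrite inE => /covered[lam pS].
  by rewrite (bigD1 lam) //= pS.
rewrite exchange_big /= -cardL -sum_nat_const; apply: leq_sum => lam _.
apply: leq_trans (leS lam).
rewrite -sum1_card big_mkcond [X in (_ <= X)%N]big_mkcond.
by apply: leq_sum => p _; case: (p \in D); case: (p \in S lam).
Qed.

End Count.

(** * Values of [delta] on codewords, and the two conclusions *)

Lemma natr_subr1 (n : nat) : (0 < n)%N -> n%:R - 1 = n.-1%:R :> rat.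
Proof. by case: n => // n _; rewrite -natr1 addrK. Qed.

(** Serves to show that a nonzero [v] has a nonzero codeword, by comparing values of [delta]. *)
Lemma delta0 (F : finFieldType) (L : splittingFieldType F) (t : nat)
  (nu : 'I_t -> nat) : delta (0 : 'rV[L]_(\sum_i nu i)) = 0.
Proof.
rewrite /delta big1 // => i _.
suff -> : rank_list (0 : 'rV[L]_(\sum_i nu i)) i = 0%N.
  by rewrite subn0 subrr mul0r.
apply/eqP; rewrite /rank_list /rk dimv_eq0 -subv0.
apply/span_subvP=> _ /imageP[j _ ->].
by rewrite /submxrow !mxE mem0v.
Qed.

Lemma delta_codeword (F : finFieldType) (L : splittingFieldType F) (k : nat)
  (theta : {rmorphism L -> L})
  (sigma : {bilinear Lspace L k -> Lspace L k -> L | *%R & theta \; *%R})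
  (t : nat) (nu : 'I_t -> nat) (G : forall i, 'M[L]_(k, nu i))
  (U : 'I_t -> {vspace (Fspace L k)}) (n e : nat) (v : Lspace L k) :
  nondegenerate_form sigma ->
  (forall i, basis_of (trace_perp sigma (U i))
               [seq col_vec (G i) j | j : 'I_(nu i)]) ->
  (forall i, \dim (U i) = n) -> (forall i, scattered (U i)) ->
  (e + \dim {:L} + n)%N = \dim {:Fspace L k} -> v != 0 ->
  delta (codeword sigma G v) = #|F|%:R ^+ e *
    (t%:R * (#|F|%:R ^+ \dim {:L} - 1) / (#|F|%:R - 1)
      - (\sum_i \dim (U i :&: Lline v))%:R).
Proof.
move=> nondeg Gb dimU scatU dimW v0.
have q1 : #|F|%:R - 1 != 0 :> rat.
  by rewrite subr_eq0 pnatr_eq1 neq_ltn finNzRing_gt1 orbT.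
have sum_t (x : rat) : t%:R * x = \sum_(i < t) x.
  by rewrite sumr_const card_ord mulr_natl.
rewrite natr_sum mulrBr -(mulrA t%:R) sum_t !mulr_sumr -sumrB.
apply: eq_bigr => i _.
have := rank_list_codeword Gb v i.
have := dim_trace_perp nondeg (U i + Lline v)%VS.
have := dimv_sum_cap (U i) (Lline v).
have := dim_trace_perp nondeg (U i).
rewrite (dim_perp_nu Gb) dimU dim_Lline // -dimW => /addIn-> dcap dperp rkE.
have perpE : \dim (trace_perp sigma (U i + Lline v)%VS)
    = (e + \dim (U i :&: Lline v))%N.
  apply/eqP; rewrite -(eqn_add2r (\dim (U i + Lline v))) dperp.
  by rewrite -!addnA eqn_add2l addnC -dcap addnC.
rewrite -[X in (X - _)%N]rkE addnK perpE !exprD -!mulrBr -mulrA; congr (_ * _).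
(* By scatteredness the exponent w is 0 or 1, the cases in which (q^w - 1) / (q - 1) = w. *)
have := scatU i v v0; case: (\dim (U i :&: Lline v)) => [|[|//]] _.
  by rewrite expr0 subr0.
rewrite expr1; apply: (mulIf q1).
by rewrite [RHS]mulrBl !divfK // mul1r opprB addrA subrK.
Qed.

Theorem theorem4p21
  (F : finFieldType) (L : splittingFieldType F) (q m k t n : nat)
  (hq : #|F| = q) (hm : \dim {:L} = m)
  (theta : {rmorphism L -> L})
  (sigma : {bilinear Lspace L k -> Lspace L k -> L | *%R & theta \; *%R})
  (sigma_refl : reflexive_form sigma)
  (sigma_nondeg : nondegenerate_form sigma)
  (B : m.-tuple L) (hB : basis_of {:L} B)
  (U : 'I_t -> {vspace (Fspace L k)})
  (hn : (1 <= n)%N)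
  (hrank : forall i, \dim (U i) = n)
  (hscat : forall i, scattered (U i))
  (hdisj : forall i j, i != j ->
     forall P, ~ (linear_set (U i) P /\ linear_set (U j) P))
  (hcover : ~ (forall P, pg_point P <-> exists i, linear_set (U i) P))
  (hline : ~ exists P, \dim P = 1%N /\
     contains_Lsub (\bigcap_(i < t) U i)%VS P)
  (C0 : {vspace 'rV[L]_(\sum_(i < t) n)})
  (hC0 : associated_code U C0)
  (nu : 'I_t -> nat)
  (C : {vspace 'rV[L]_(\sum_(i < t) nu i)})
  (hC : associated_code (fun i => trace_perp sigma (U i)) C)
  (ht : (q%:R - 1) * (q%:R ^+ m / (q%:R ^+ m - 1)) < t%:R :> rat) :
  minimal_code B C /\ AB_condition C.
Proof.
case: hC => _ [G Gb ->]; subst q m.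
have q1 : 1 < #|F|%:R :> rat by rewrite ltr1n finNzRing_gt1.
have m0 : (0 < \dim {:L})%N by have := dimvS (sub1v {:L}%AS); rewrite dimv1.
have Q1 : 1 < #|F|%:R ^+ \dim {:L} :> rat by rewrite exprn_egt1 // -lt0n.
have codeP c : c \in generated_code G <-> exists v, c = codeword sigma G v.
  exact: generated_code_codeword.
split.
  move=> c c' /codeP[v ->] /codeP[v' ->] sub.
  have [/existsP[a /eqP->] | /existsPn far] :=
      boolP [exists a : finvect_type L, v' == (a : L) *: v].
    by exists (theta a); apply: codewordZ.
  have sub_line i := support_codeword sigma_nondeg Gb hB (sub i).
  have := incidence_count hscat hdisj far sub_line.
  (* The count t (Q - 1) <= Q (q - 1) contradicts [ht] after clearing denominators. *)
  rewrite leqNgt => /negP[]; rewrite -(ltr_nat rat) !natrM.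
  rewrite -natr_subr1 ?(ltnW (finNzRing_gt1 F)) //.
  rewrite -natr_subr1 ?expn_gt0 ?(ltnW (finNzRing_gt1 F)) // natrX.
  by rewrite mulrC -ltr_pdivrMr ?subr_gt0 // -mulrA.
set Q := _ ^+ _ in Q1; set D := t%:R * (Q - 1) / (#|F|%:R - 1).
have DQ : Q < D.
  rewrite /D ltr_pdivlMr ?subr_gt0 // mulrC -ltr_pdivrMr ?subr_gt0 //.
  by rewrite -mulrA.
(* For t = 0 the number [D] would be 0, yet it exceeds Q > 1. *)
have i0 : 'I_t.
  case: (t) @D DQ => [|t0] D DQ; last exact: ord0.
  by move: DQ; rewrite /D !mul0r => /(lt_trans Q1); rewrite ltr10.
pose w v := (\sum_i \dim (U i :&: Lline v))%N.
have w_le1 v : v != 0 -> (w v <= 1)%N by apply: dim_meet_le1.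
have [v0 v0_neq0 wv0] : exists2 v0 : Lspace L k, v0 != 0 & w v0 = 0%N.
  have [/existsP[v /andP[v0 /eqP wv]] | /existsPn none] :=
      boolP [exists v : finvect_type (Fspace L k), (v != 0) && (w v == 0%N)].
    by exists v.
  (* If [w] vanished at no nonzero vector, the linear sets would cover every point. *)
  case: hcover => P; split=> [P1 | [i [u [_ u0] ->]]]; last first.
    by rewrite /pg_point dim_vline u0.
  have P0 : P != 0%VS by rewrite -dimv_eq0 P1.
  have pick0 : vpick P != 0 by rewrite vpick0.
  have PE : P = <[vpick P]>%VS.
    apply/esym/eqP; rewrite eqEdim -memvE memv_pick /= P1 dim_vline.
    by rewrite pick0.
  have := none (vpick P); rewrite negb_and pick0 /= sum_nat_eq0 negb_forall.
  case/existsP=> i; rewrite -lt0n => wi; exists i; rewrite PE.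
  exact/linear_set_meet.
pose e := (\dim {:Fspace L k} - \dim {:L} - n)%N.
(* The truncated subtractions in [e] are exact: [U i0] and [Lline v0] meet trivially, so their sum
   has dimension n + m inside the whole space. *)
have dimW : (e + \dim {:L} + n)%N = \dim {:Fspace L k}.
  have := dimvS (subvf (U i0 + Lline v0)%VS).
  have := dimv_sum_cap (U i0) (Lline v0).
  move/eqP: wv0; rewrite sum_nat_eq0 => /forallP/(_ i0)/eqP->.
  rewrite addn0 hrank dim_Lline // => -> le.
  by rewrite -addnA /e -subnDA subnK // addnC.
have deltaE v : v != 0 ->
    delta (codeword sigma G v) = #|F|%:R ^+ e * (D - (w v)%:R).
  exact: delta_codeword.
have qe : 0 < #|F|%:R ^+ e :> rat by rewrite exprn_gt0 // (lt_trans ltr01).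
(* A zero codeword would give [D = w v <= 1], against 1 < Q < [D]. *)
have cw_neq0 v : v != 0 -> codeword sigma G v != 0.
  move=> vn0; apply: contraTneq (w_le1 v vn0) => cw0.
  have := deltaE v vn0; rewrite cw0 delta0 => /esym/eqP.
  rewrite mulf_eq0 gt_eqF //= subr_eq0 => /eqP Dw.
  by rewrite -ltnNge -(ltr_nat rat) -Dw (lt_trans Q1).
have cwP c : c \in generated_code G -> c != 0 ->
    exists2 v, v != 0 & c = codeword sigma G v.
  move=> /codeP[v ->] c0; exists v => //; apply: contraNneq c0 => ->.
  by rewrite -(scale0r (0 : Lspace L k)) codewordZ rmorph0 scale0r.
have [v1 v1_neq0 wv1] : exists2 v1 : Lspace L k, v1 != 0 & w v1 = 1%N.
  (* As n >= 1, [U i0] has a nonzero vector, whose line meets [U i0]. *)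
  have pick0 : vpick (U i0) != 0 by rewrite vpick0 -dimv_eq0 hrank -lt0n.
  exists (vpick (U i0)) => //; apply/eqP; rewrite eqn_leq w_le1 //=.
  rewrite /w (bigD1 i0) //= ltn_addr // lt0n dimv_eq0.
  apply: contraNneq pick0 => cap0; rewrite -memv0 -cap0 memv_cap memv_pick /=.
  by apply/mem_Lline; exists 1; rewrite scale1r.
exists (#|F|%:R ^+ e * D), (#|F|%:R ^+ e * (D - 1)); split.
- split; first exists (codeword sigma G v0).
  + by split; [apply/codeP; exists v0 | apply: cw_neq0].
  + by rewrite deltaE // wv0 subr0.
  + move=> c cC /cwP[]// v vn0 ->; rewrite deltaE // ler_pM2l //.
    by rewrite gerBl.
- split; first exists (codeword sigma G v1).
  + by split; [apply/codeP; exists v1 | apply: cw_neq0].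
  + by rewrite deltaE // wv1.
  + move=> c cC /cwP[]// v vn0 ->; rewrite deltaE // ler_pM2l // lerD2l lerN2.
    by rewrite lern1 w_le1.
(* The factor q^e cancels, and [D / (D - 1) < Q / (Q - 1)] is equivalent to [Q < D] as both exceed
   1. *)
rewrite -mulf_div divff ?gt_eqF // mul1r -/Q.
have D1 : 1 < D by apply: lt_trans DQ.
rewrite ltr_pdivrMr ?subr_gt0 // mulrAC ltr_pdivlMr ?subr_gt0 //.
by rewrite mulrBr mulr1 mulrBr mulr1 mulrC ltrD2l ltrN2.
Qed.
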